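(* Let $R$ be a commutative ring with identity whose characteristic is not $2$, let $M$ be a nonzero free $R$-module of finite rank with an antisymmetric bilinear form $\langle\cdot,\cdot\rangle : M\times M\to R$ such that $\langle x,x\rangle=0$ for all $x\in M$, and let $(M,* )$ be the associated symplectic quandle, $x*y = x+\langle x,y\rangle y$. If there exists a hyperbolic pair of $M$, that is, elements $e,f\in M$ with $\langle e,f\rangle=1$, then there exists no good involution of $(M,* )$.
   Context: A quandle is a set $X$ with a binary operation $*$ such that $x*x=x$ for all $x$; for all $x,y\in X$ there is a unique $z\in X$ with $z*y=x$; and $(x*y)*z=(x*z)*(y*z)$ for all $x,y,z$. The dual operation $*^{-1}$ is defined by $(x*y)*^{-1}y=x$ and $(x*^{-1}y)*y=x$. An involution of $X$ is a map $\rho:X\to X$ with $\rho\circ\rho=\mathrm{id}_X$ (the identity is allowed). A good involution of $(X,* )$ is an involution $\rho$ (not assumed to be $R$-linear when $X$ is an $R$-module) such that (1) $\rho(x*y)=\rho(x)*y$ and (2) $x*\rho(y)=x*^{-1}y$ for all $x,y\in X$. For the symplectic quandle $(M,* )$ with $x*y=x+\langle x,y\rangle y$, the dual operation is $x*^{-1}y=x-\langle x,y\rangle y$. *)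

(* Defs.v *)
From HB Require Import structures.
From mathcomp Require Import all_boot all_order all_algebra.

Set Implicit Arguments.
Unset Strict Implicit.
Unset Printing Implicit Defensive.

Import GRing.Theory.
Local Open Scope ring_scope.

Record quandle := Quandle {
  quandle_sort :> choiceType;
  qmul : quandle_sort -> quandle_sort -> quandle_sort;
  qmul_idem : forall x, qmul x x = x;
  qmul_div : forall x y, exists! z, qmul z y = x;
  qmul_dist : forall x y z,
    qmul (qmul x y) z = qmul (qmul x z) (qmul y z)
}.

Lemma qdiv_exists (X : quandle) (x y : X) : exists z : X, qmul z y == x.
Proof. by have [z [/eqP zP _]] := qmul_div x y; exists z. Qed.

(* The dual operation: the unique z with z * y = x.  It is characterised by
   [qmulK] and [qdivK]. *)
Definition qdiv (X : quandle) (x y : X) : X := xchoose (qdiv_exists x y).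

Lemma qdivK (X : quandle) (x y : X) : qmul (qdiv x y) y = x.
Proof. exact/eqP/(xchooseP (qdiv_exists x y)). Qed.

Lemma qmulK (X : quandle) (x y : X) : qdiv (qmul x y) y = x.
Proof.
have [z [_ zU]] := qmul_div (qmul x y) y.
exact: etrans (esym (zU _ (qdivK _ y))) (zU x erefl).
Qed.

Record good_involution (X : quandle) (rho : X -> X) : Prop := GoodInvolution {
  good_involutive : involutive rho;
  good_qmull : forall x y, rho (qmul x y) = qmul (rho x) y;
  good_qmulr : forall x y, qmul x (rho y) = qdiv x y
}.

Section SymplecticQuandle.
Variables (R : comNzRingType) (M : lmodType R) (form : {biscalar M}).
Hypothesis form_alt : forall x, form x x = 0.

Definition symp_mul (x y : M) : M := x + form x y *: y.

Lemma symp_mul_idem x : symp_mul x x = x.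
Proof. by rewrite /symp_mul form_alt scale0r addr0. Qed.

Lemma symp_mul_form x y z : form (symp_mul x z) (symp_mul y z) = form x y.
Proof.
have form_anti u v : form u v = - form v u.
  apply/eqP; rewrite -addr_eq0; apply/eqP.
  by have := form_alt (u + v); rewrite linearDl !linearD /= !form_alt add0r addr0.
rewrite /symp_mul linearDl !linearD /= !linearZl_LR !linearZ /= form_alt.
by rewrite !mulr0 addr0 [form z y]form_anti mulrN mulrC -addrA subrr addr0.
Qed.

Lemma symp_mul_div x y : exists! z, symp_mul z y = x.
Proof.
have formK a b c : form (a + c *: b) b = form a b.
  by rewrite linearDl /= linearZl_LR /= form_alt mulr0 addr0.
exists (x - form x y *: y); split=> [|z <-].
  by rewrite /symp_mul -scaleNr formK scaleNr addrNK.
by rewrite /symp_mul formK addrK.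
Qed.

Lemma symp_mul_dist x y z :
  symp_mul (symp_mul x y) z = symp_mul (symp_mul x z) (symp_mul y z).
Proof.
rewrite [in RHS]/symp_mul symp_mul_form /symp_mul linearDl /= linearZl_LR /=.
by rewrite scalerDl scalerDr scalerA -!addrA; congr (_ + _); rewrite addrCA.
Qed.

Definition symplectic_quandle : quandle :=
  @Quandle M symp_mul symp_mul_idem symp_mul_div symp_mul_dist.

Lemma symp_qdivE (x y : symplectic_quandle) :
  qdiv x y = (x : M) - form x y *: (y : M).
Proof.
have [z [_ zU]] := symp_mul_div x y.
rewrite -(zU _ (@qdivK symplectic_quandle x y)); apply: zU.
rewrite /symp_mul -scaleNr linearDl /= linearZl_LR /= form_alt mulr0 addr0.
by rewrite scaleNr addrNK.
Qed.

End SymplecticQuandle.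

Definition hyperbolic_pair (R : comNzRingType) (M : lmodType R)
  (form : {biscalar M}) (e f : M) : Prop := form e f = 1.

(* Main.v *)
Require Import Defs.
From HB Require Import structures.
From mathcomp Require Import all_boot all_order all_algebra.

Import GRing.Theory.
Local Open Scope ring_scope.

(** Write [e, f] for the hyperbolic pair and suppose that [rho] is a good
involution.  Equating [e * rho f] with the dual product of [e] and [f] gives
[form e (rho f) *: rho f = - f], and pairing with [e] shows that the scalar
[a := form e (rho f)] satisfies [a ^+ 2 = -1]; hence [rho f = a *: f]
([good_involution_scale]).

Since [rho] commutes with right translations, and these are linear, [rho]
multiplies by this same [a] every element reached from [f] by right
translations.  One such element is [- a *: f] ([symp_path_scale]), so
[rho (- a *: f) = - a ^+ 2 *: f = f].  But [rho (a *: f) = f] too, because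
[rho] is involutive and [rho f = a *: f].  By injectivity [- a *: f = a *: f];
pairing with [e] and cancelling the unit [a] gives [2 = 0] in [R]. *)

Section SymplecticGoodInvolution.
Set Implicit Arguments.
Unset Strict Implicit.
Variables (R : comNzRingType) (M : lmodType R) (form : {biscalar M}).
Hypothesis form_alt : forall x, form x x = 0.
Variables e f : M.
Hypothesis form_ef : form e f = 1.

Lemma form_fe : form f e = -1.
Proof.
apply/eqP; rewrite -addr_eq0; apply/eqP.
have := form_alt (f + e).
by rewrite linearDl !linearD /= !form_alt form_ef add0r addr0.
Qed.

Lemma symp_mulZ (c : R) (x y : M) :
  symp_mul form (c *: x) y = c *: symp_mul form x y.
Proof. by rewrite /symp_mul linearZl_LR /= scalerDr scalerA. Qed.

(** The axiom on [x * rho y] at [x = e], [y = f] reads [a *: rho f = - f],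
where [a] is [form e (rho f)];
pairing it with [e] gives [a ^+ 2 = -1], so that multiplying it by [a] solves
it for [rho f]. *)
Lemma good_involution_scale
    (rho : symplectic_quandle form_alt -> symplectic_quandle form_alt) :
  good_involution rho ->
  exists2 a : R, a * a = -1 & (rho f : M) = a *: f.
Proof.
move=> rhoG; pose g : M := rho f; pose a := form e g.
have ag : a *: g = - f.
  have := good_qmulr rhoG (e : symplectic_quandle form_alt) f.
  by rewrite symp_qdivE form_ef scale1r => /addrI.
have aa : a * a = -1.
  by have := congr1 (form e) ag; rewrite linearZ linearN /= form_ef.
exists a => //; apply: oppr_inj.
by rewrite -[rho f]/g -scalerN -ag scalerA aa scaleN1r.
Qed.

(** Translating [f] by [(1 + a) *: e + f] gives [- 2a *: e - a *: f], because
[(1 + a) ^+ 2 = 2a]; each of the two translations by [e] then adds [a *: e]. *)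
Lemma symp_path_scale (a : R) : a * a = -1 ->
  symp_mul form (symp_mul form (symp_mul form f ((1 + a) *: e + f)) e) e
    = - a *: f.
Proof.
move=> aa.
have step1 : symp_mul form f ((1 + a) *: e + f) = - a *: f - (a + a) *: e.
  have fy : form f ((1 + a) *: e + f) = - (1 + a).
    by rewrite linearD linearZ /= form_fe form_alt addr0 mulrN1.
  have sq : (1 + a) * (1 + a) = a + a.
    by rewrite mulrDl !mulrDr aa !mul1r mulr1 [1 + a]addrC addrACA subrr addr0.
  rewrite /symp_mul fy scalerDr scalerA mulNr sq scaleNr addrCA addrC.
  by rewrite -{1}[f]scale1r -scalerDl opprD addNKr.
have stepe p : symp_mul form (- a *: f + p *: e) e = - a *: f + (p + a) *: e.
  rewrite /symp_mul linearDl !linearZl_LR /= form_fe form_alt mulr0 addr0.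
  by rewrite mulrN1 opprK -addrA -scalerDl.
by rewrite step1 -scaleNr !stepe -addrA addNr scale0r addr0.
Qed.

End SymplecticGoodInvolution.

Theorem theorem1p5 (R : comNzRingType) (char_neq2 : 2%N \notin [pchar R])
  (M : vectType R) (M_neq0 : exists x : M, x != 0)
  (form : {biscalar M})
  (form_anti : forall x y : M, form x y = - form y x)
  (form_alt : forall x : M, form x x = 0)
  (has_hyp : exists e f : M, hyperbolic_pair form e f) :
  ~ exists rho : symplectic_quandle form_alt -> symplectic_quandle form_alt,
      good_involution rho.
Proof.
case=> rho rhoG; have [e [f]] := has_hyp.
rewrite /hyperbolic_pair => form_ef.
have [a aa rhof] := good_involution_scale form_ef rhoG.
have rho_mul (x y : M) : rho (symp_mul form x y) = symp_mul form (rho x) y.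
  exact: (good_qmull rhoG).
have rho_path : rho (- a *: f) = f.
  rewrite -(symp_path_scale form_alt form_ef aa) !rho_mul rhof !symp_mulZ.
  rewrite (symp_path_scale form_alt form_ef aa).
  by rewrite scalerA mulrN aa opprK scale1r.
have af : - a *: f = a *: f.
  by rewrite -rhof -{2}rho_path (good_involutive rhoG).
have aN : - a = a.
  by have := congr1 (form e) af; rewrite !linearZ /= form_ef !mulr1.
move/negP: char_neq2; apply; rewrite inE /=; apply/eqP.
(* Multiplying [a + a = 0] by [a] turns it into [- 2 = 0]. *)
apply: oppr_inj; rewrite oppr0 mulr2n opprD -aa -mulrDr.
by rewrite -{2}aN addNr mulr0.
Qed.
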